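(* Let $T$ be a (nonempty) top-cycle-free chord diagram. Then $T$ is 1-terminal if and only if the intersection graph of $T$ is a tree and every non-terminal chord of $T$ has exactly one right neighbor.
   Context: A chord diagram of size $n$ is a perfect matching of $\{1,\dots,2n\}$; chords are ordered pairs $(a,b)$ with $a<b$, $a$ the source and $b$ the sink. A subset of chords is a subdiagram, viewed as a diagram by order-preserving relabelling of endpoints. For chords $c_1=(a_1,b_1)$, $c_2=(a_2,b_2)$ with $a_1<a_2$, they cross if $a_2<b_1<b_2$, and then $c_2$ is a right neighbor of $c_1$. The intersection graph has chords as vertices and crossings as (undirected) edges. A chord is terminal if it has no right neighbors. A diagram is 1-terminal if no chord other than the last one, in the order of sources, is terminal. For $m\ge3$ the top cycle diagram of size $m$ is $T_m=\{(2i-1,2i+2):1\le i\le m-1\}\cup\{(2,2m-1)\}$; a diagram is top-cycle-free if no subdiagram of it equals (after relabelling) some $T_m$, $m\ge3$. *)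

(* Defs.v *)
From mathcomp Require Import all_boot finmap.

Set Implicit Arguments.
Unset Strict Implicit.
Unset Printing Implicit Defensive.

Local Open Scope fset_scope.
Local Open Scope nat_scope.

Notation chord := (nat * nat)%type.

Definition incident (x : nat) (c : chord) : bool := (x == c.1) || (x == c.2).

(* Points are numbered from 1, so a diagram of size n lives on {1, ..., 2n}. *)
Definition chord_diagram (n : nat) (D : {fset chord}) : Prop :=
  [/\ forall c, c \in D -> [&& 1 <= c.1, c.1 < c.2 & c.2 <= 2 * n]
    & forall x, 1 <= x <= 2 * n -> #|` [fset c in D | incident x c]| = 1].

Definition endpoints (S : {fset chord}) : {fset nat} :=
  [fset c.1 | c in S] `|` [fset c.2 | c in S].

(* The position of x among the endpoints of S, counted from 1. *)
Definition rank (S : {fset chord}) (x : nat) : nat :=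
  #|` [fset y in endpoints S | y <= x]|.

Definition relabel (S : {fset chord}) : {fset chord} :=
  [fset (rank S c.1, rank S c.2) | c in S].

Definition right_neighbor (c d : chord) : bool :=
  [&& c.1 < d.1, d.1 < c.2 & c.2 < d.2].

Definition crosses (c d : chord) : bool :=
  right_neighbor c d || right_neighbor d c.

Definition right_neighbors (D : {fset chord}) (c : chord) : {fset chord} :=
  [fset d in D | right_neighbor c d].

Definition terminal (D : {fset chord}) (c : chord) : bool :=
  right_neighbors D c == fset0.

Definition last_chord (D : {fset chord}) (c : chord) : Prop :=
  c \in D /\ forall d, d \in D -> d.1 <= c.1.

Definition one_terminal (D : {fset chord}) : Prop :=
  forall c, c \in D -> ~ last_chord D c -> ~~ terminal D c.

Definition top_cycle (m : nat) : {fset chord} :=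
  (2, 2 * m - 1) |` [fset (2 * i - 1, 2 * i + 2) | i in iota 1 (m - 1)].

Definition top_cycle_free (D : {fset chord}) : Prop :=
  forall S : {fset chord}, S `<=` D ->
  forall m : nat, 3 <= m -> relabel S <> top_cycle m.

Definition intersection_graph (D : {fset chord}) : rel D :=
  fun c d => crosses (val c) (val d).
Arguments intersection_graph : clear implicits.

(* For a symmetric irreflexive adjacency relation e. A closed walk x, y, x is
   a ucycle of size 2, whence the size bound in the acyclicity condition. *)
Definition is_tree (V : finType) (e : rel V) : Prop :=
  [/\ 0 < #|V|,
      forall x y : V, connect e x y
    & forall s : seq V, 3 <= size s -> ~ ucycle e s].

(* Main.v *)
(** A 1-terminal diagram is connected, because following right neighbors from
    any chord leads to the last one. If some chord [c] had two right neighbors,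
    then, in the absence of a [T_3], they would be nested; let [d] be the outer
    one. Following right neighbors from the inner one eventually leaves [d],
    and a shortest such path from [c] forms a top cycle together with [d]. So
    right neighbors are unique, and a cycle is impossible, because its chord
    with the least source would have two right neighbors. Conversely, if right
    neighbors are unique, then the chords from which a given terminal chord is
    reached through right neighbors form a connected component; when the graph
    is connected, every chord therefore starts before the terminal one. *)
Require Import Defs.
From mathcomp Require Import all_boot finmap zify.

Set Implicit Arguments.
Unset Strict Implicit.
Unset Printing Implicit Defensive.

Local Open Scope fset_scope.
Local Open Scope nat_scope.

(** * Relabelling, and the endpoints of a top cycle *)

Lemma endpointsP (D : {fset chord}) (x : nat) :
  reflect (exists2 c, c \in D & incident x c) (x \in endpoints D).
Proof.
rewrite /endpoints in_fsetU; apply: (iffP orP) => [[]/imfsetP[c /= cD ->]|].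
- by exists c; rewrite // /incident eqxx.
- by exists c; rewrite // /incident eqxx orbT.
by case=> c cD /orP[]/eqP->; [left | right]; apply: in_imfset.
Qed.

(** The endpoints of the image up to [f j] are exactly [f 1], ..., [f j], so [rank] undoes [f]. To
    find a top cycle in a diagram it thus suffices to place its points there in increasing order. *)
Lemma relabel_image (N : nat) (f : nat -> nat) (D : {fset chord}) :
    endpoints D =i iota 1 N ->
    {in iota 1 N &, {mono f : x y / x <= y}} ->
  relabel [fset (f c.1, f c.2) | c in D] = D.
Proof.
move=> endD f_mono; set S := [fset _ | c in D].
have f_inj : {in iota 1 N &, injective f}.
  move=> i j iN jN eq_f; apply/eqP.
  by rewrite eqn_leq -(f_mono i j) // -(f_mono j i) // eq_f leqnn.
have endS : endpoints S = [fset f i | i in iota 1 N].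
  apply/fsetP => y; apply/endpointsP/imfsetP => /=.
    case=> _ /imfsetP[c /= cD ->] /orP[]/= /eqP->.
      exists c.1; rewrite // -endD; apply/endpointsP.
      by exists c; rewrite // /incident eqxx.
    exists c.2; rewrite // -endD; apply/endpointsP.
    by exists c; rewrite // /incident eqxx orbT.
  case=> i; rewrite -endD => /endpointsP[c cD ic] ->.
  exists (f c.1, f c.2); first by apply/imfsetP; exists c.
  by case/orP: ic => /eqP->; rewrite /incident /= eqxx ?orbT.
have rankS j : j \in iota 1 N -> rank S (f j) = j.
  move=> jN; rewrite /rank endS.
  have -> : [fset y in [fset f i | i in iota 1 N] | y <= f j]
            = [fset f i | i in iota 1 j].
    apply/fsetP => y; rewrite !inE /=; apply/andP/imfsetP => /=.
      case=> /imfsetP[i /= iN ->]; rewrite f_mono // => le_ij.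
      by exists i => //; rewrite !mem_iota in iN *; lia.
    case=> i ij ->; have iN : i \in iota 1 N.
      by rewrite !mem_iota in ij jN *; lia.
    split; first by apply/imfsetP; exists i.
    by rewrite f_mono //; rewrite mem_iota in ij; lia.
  rewrite card_in_imfset /= ?size_iota.
    by rewrite -[RHS](size_iota 1 j) undup_id ?iota_uniq.
  move=> i i' ij ij'; apply: f_inj; rewrite !mem_iota in ij ij' jN *; lia.
have endDl c : c \in D -> c.1 \in iota 1 N.
  move=> cD; rewrite -endD; apply/endpointsP.
  by exists c; rewrite // /incident eqxx.
have endDr c : c \in D -> c.2 \in iota 1 N.
  move=> cD; rewrite -endD; apply/endpointsP.
  by exists c; rewrite // /incident eqxx orbT.
apply/fsetP => c; apply/imfsetP/idP => /= [[_ /imfsetP[d /= dD ->] ->]|cD].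
  by rewrite /= !rankS ?endDl ?endDr // -surjective_pairing.
exists (f c.1, f c.2); first by apply/imfsetP; exists c.
by rewrite /= !rankS ?endDl ?endDr // -surjective_pairing.
Qed.

Lemma endpoints_top_cycle (m : nat) :
  3 <= m -> endpoints (top_cycle m) =i iota 1 (2 * m).
Proof.
move=> m_ge3 x; rewrite mem_iota; apply/endpointsP/idP.
  case=> c; rewrite /top_cycle in_fset1U => /orP[/eqP->|/imfsetP[i /= im ->]].
    by case/orP => /eqP->; rewrite /=; lia.
  by rewrite mem_iota in im; case/orP => /eqP->; rewrite /=; lia.
(* Apart from the two ends of the chord [(2, 2 * m - 1)], an odd point is a source [2 * i - 1] and
   an even one a sink [2 * i + 2]; solve for [i]. *)
move=> xm; pose i := if odd x then x./2.+1 else x./2.-1.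
have [xd | xd] := boolP ((x == 2) || (x == 2 * m - 1)).
  by exists (2, 2 * m - 1); rewrite // /top_cycle in_fset1U eqxx.
exists (2 * i - 1, 2 * i + 2); last first.
  by rewrite /incident /i /=; case: ifP; lia.
rewrite /top_cycle in_fset1U; apply/orP; right.
by apply/imfsetP; exists i => //=; rewrite mem_iota /i; case: ifP; lia.
Qed.

Lemma last_chord_max (D : {fset chord}) (l c : chord) :
  last_chord D l -> c \in D -> c.1 <= l.1.
Proof. by case=> _; apply. Qed.

(** * Top cycles from paths of right neighbors *)

Section Diagram.

Variables (n : nat) (T : {fset chord}).
Hypothesis T_diagram : chord_diagram n T.

Lemma chord_bounds (c : chord) :
  c \in T -> [&& 1 <= c.1, c.1 < c.2 & c.2 <= 2 * n].
Proof. by case: T_diagram => bnd _; apply: bnd. Qed.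

Lemma incident_inj (x : nat) (c d : chord) :
  c \in T -> d \in T -> incident x c -> incident x d -> c = d.
Proof.
case: T_diagram => _ uniqx cT dT xc xd.
have x_n : 1 <= x <= 2 * n.
  by have := chord_bounds cT; case/orP: xc => /eqP->; lia.
have /eqP/cardfs1P[e De] := uniqx x x_n.
have : c \in [fset e] by rewrite -De !inE /= cT.
have : d \in [fset e] by rewrite -De !inE /= dT.
by rewrite !inE => /eqP-> /eqP->.
Qed.

Lemma endpoints_neq (c d : chord) : c \in T -> d \in T -> c.1 != d.1 ->
  (c.2 != d.2) && (c.2 != d.1).
Proof.
move=> cT dT; apply: contraNT; rewrite negb_and !negbK.
case/orP => /eqP eq_cd; rewrite (@incident_inj c.2 c d) //;
  by rewrite /incident ?eq_cd eqxx ?orbT.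
Qed.

(* The hypotheses place the endpoints of [d], [e 0], ..., [e k] in the order
   prescribed by [T_(k + 2)], in which [d] is the chord (2, 2 k + 3). *)
Lemma top_cycle_of_path (k : nat) (e : nat -> chord) (d : chord) :
    top_cycle_free T -> 0 < k -> d \in T ->
    (forall i, i <= k -> e i \in T) ->
    (forall i, i < k -> right_neighbor (e i) (e i.+1)) ->
    (forall i, i.+1 < k -> (e i).2 < (e i.+2).1) ->
    (e 0).1 < d.1 < (e 1).1 -> (e k.-1).2 < d.2 < (e k).2 ->
  False.
Proof.
move=> T_tcf k_gt0 dT eT e_rn e_gap d_source d_sink.
have m_ge3 : 3 <= k.+2 by [].
(* The chord [e i] takes the positions [2 * i + 1] and [2 * i + 4]; halving recovers [i]. *)
pose f j := if j == 2 then d.1 else if j == 2 * k + 3 then d.2 else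
            if odd j then (e j./2).1 else (e (j./2 - 2)).2.
have f_odd i : i <= k -> f (2 * i + 1) = (e i).1.
  move=> ik; rewrite /f; do 2 (case: ifP; first by lia).
  by move=> _ _; rewrite ifT; [congr (e _).1 |]; lia.
have f_even i : i <= k -> f (2 * i + 4) = (e i).2.
  move=> ik; rewrite /f; do 2 (case: ifP; first by lia).
  by move=> _ _; rewrite ifF; [congr (e _).2 |]; lia.
have f2 : f 2 = d.1 by [].
have fd : f (2 * k + 3) = d.2.
  by rewrite /f eqxx; case: ifP => //; lia.
have f_succ j : 1 <= j < 2 * k + 4 -> f j < f j.+1.
  move=> j_bnd.
  have [j1|j1] := eqVneq j 1.
    by rewrite j1 (f_odd 0) // f2; lia.
  have [j2|j2] := eqVneq j 2.
    by rewrite j2 f2 (f_odd 1) //; lia.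
  have [jd|jd] := eqVneq j (2 * k + 3).
    rewrite jd fd (_ : (2 * k + 3).+1 = 2 * k + 4) ?f_even; lia.
  have [jd'|jd'] := eqVneq j (2 * k + 2).
    rewrite jd' (_ : (2 * k + 2).+1 = 2 * k + 3) ?fd; last lia.
    by rewrite (_ : 2 * k + 2 = 2 * k.-1 + 4) ?f_even; lia.
  (* Away from [d], the source of [e i.+1] is followed by the sink of [e i], as these cross, and the
     sink of [e i] by the source of [e i.+2], by [e_gap]. *)
  have [j_odd|j_even] := boolP (odd j).
    pose i := j./2.-1.
    rewrite (_ : j = 2 * i.+1 + 1) ?f_odd; [|rewrite /i; lia..].
    rewrite (_ : (2 * i.+1 + 1).+1 = 2 * i + 4) ?f_even; [|rewrite /i; lia..].
    by have /and3P[] : right_neighbor (e i) (e i.+1) by apply: e_rn; rewrite /i; lia.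
  pose i := j./2 - 2.
  rewrite (_ : j = 2 * i + 4) ?f_even; [|rewrite /i; lia..].
  rewrite (_ : (2 * i + 4).+1 = 2 * i.+2 + 1) ?f_odd; [|rewrite /i; lia..].
  by apply: e_gap; rewrite /i; lia.
have f_lt i j : 1 <= i -> i < j <= 2 * k + 4 -> f i < f j.
  move=> i_ge1; elim: j => [|j IHj] ij; first lia.
  have [-> | ne_ij] := eqVneq i j; first by apply: f_succ; lia.
  by apply: ltn_trans (IHj _) (f_succ _ _); lia.
have f_mono : {in iota 1 (2 * k.+2) &, {mono f : x y / x <= y}}.
  move=> i j; rewrite !mem_iota => i_bnd j_bnd.
  case: (ltngtP i j) => [lt_ij|lt_ji|->]; last by rewrite leqnn.
    by apply: ltnW; apply: f_lt; lia.
  by apply/negbTE; rewrite -ltnNge; apply: f_lt; lia.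
apply: (T_tcf _ _ _ m_ge3 (relabel_image (endpoints_top_cycle m_ge3) f_mono)).
apply/fsubsetP => _ /imfsetP[c /= + ->].
rewrite /top_cycle in_fset1U => /orP[/eqP->|/imfsetP[i /= ik ->]] /=.
  rewrite f2 (_ : 2 * k.+2 - 1 = 2 * k + 3) ?fd; last lia.
  by rewrite -surjective_pairing.
rewrite inE mem_iota in ik.
rewrite (_ : 2 * i - 1 = 2 * i.-1 + 1) ?f_odd; [|lia..].
rewrite (_ : 2 * i + 2 = 2 * i.-1 + 4) ?f_even; [|lia..].
by rewrite -surjective_pairing eT //; lia.
Qed.

(** Strong induction on [k]: the path is cut off at an earlier chord that ends after [d], or
    [e i.+1] is skipped when [e i] crosses [e i.+2]. A path allowing neither forms a top cycle with
    [d]. *)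
Lemma top_cycle_of_long_path (k : nat) (e : nat -> chord) (d : chord) :
    top_cycle_free T -> 0 < k -> d \in T ->
    (forall i, i <= k -> e i \in T) ->
    (forall i, i < k -> right_neighbor (e i) (e i.+1)) ->
    (forall i, 0 < i <= k -> d.1 < (e i).1) ->
    right_neighbor (e 0) d -> d.2 < (e k).2 ->
  False.
Proof.
move=> T_tcf + dT; elim/ltn_ind: k e => k IHk e k_gt0 eT e_rn e_source rn_d e_sink.
have [/existsP[i i_sink] | no_early] :=
    boolP [exists i : 'I_k, d.2 < (e i).2].
  have i_lt := ltn_ord i.
  have i_gt0 : 0 < i.
    by rewrite lt0n; apply: contraTneq i_sink => ->; case/and3P: rn_d; lia.
  by apply: (IHk i i_lt e) => // j j_bnd;
    [apply: eT | apply: e_rn | apply: e_source]; lia.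
have [/existsP[i i_cut] | no_cut] :=
    boolP [exists i : 'I_k, (i.+1 < k) && right_neighbor (e i) (e i.+2)].
  case/andP: i_cut => i_lt i_rn.
  pose e' j := if j <= i then e j else e j.+1.
  apply: (IHk k.-1 _ e'); rewrite /e'; [lia | lia | | | | | ].
  - by move=> j jk; case: ifP => _; apply: eT; lia.
  - move=> j jk; have [lt_ji|lt_ij|->] := ltngtP j i.
    + by apply: e_rn; lia.
    + by apply: e_rn; lia.
    + by [].
  - by move=> j jk; case: ifP => _; apply: e_source; lia.
  - by [].
  - by rewrite ifF ?prednK //; lia.
have step i : i < k -> (e i).1 < (e i.+1).1 /\ (e i).2 < (e i.+1).2.
  by move=> /e_rn/and3P[].
apply: (top_cycle_of_path T_tcf k_gt0 dT eT e_rn).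
(* Sources and sinks both increase along the path, so [e i] and [e i.+2] can fail to cross only if
   the first ends before the second starts. *)
- move=> i ik; move/existsPn: no_cut => /(_ (Ordinal (ltnW ik))) /=.
  rewrite ik /right_neighbor /=.
  have [? ?] := step i (ltnW ik); have [? ?] := step i.+1 ik.
  have ne : (e i).1 != (e i.+2).1 by lia.
  have := endpoints_neq (eT i _) (eT i.+2 ik) ne; lia.
- by have := e_source 1; case/and3P: rn_d; lia.
- have k1 : k.-1 < k by lia.
  move/existsPn: no_early => /(_ (Ordinal k1)) /= no_sink.
  rewrite e_sink andbT; have [k0 | k0] := posnP k.-1.
    by rewrite k0; case/and3P: rn_d.
  have d1 := e_source k.-1.
  have ne : d.1 != (e k.-1).1 by lia.
  have := endpoints_neq dT (eT k.-1 _) ne; lia.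
Qed.

(** * Uniqueness of right neighbors in 1-terminal diagrams *)

Lemma right_neighbor_ind (l : chord) (P : chord -> Prop) :
    one_terminal T -> last_chord T l -> P l ->
    (forall c d : chord, c \in T -> d \in T -> right_neighbor c d -> P d -> P c) ->
  forall c : chord, c \in T -> P c.
Proof.
move=> T1 l_last Pl Pstep c.
have [lT _] := l_last.
(* The distance between the sources of [c] and [l] shrinks on passing to a right neighbor. *)
have [N leN] := ubnP (l.1 - c.1); elim: N c leN => // N IHN c leN cT.
have [-> // | ne_cl] := eqVneq c l.
have not_last : ~ last_chord T c.
  move/last_chord_max/(_ lT) => le_lc; case/eqP: ne_cl.
  have eq_cl : c.1 = l.1 by apply/eqP; rewrite eqn_leq (last_chord_max l_last).
  by apply: (@incident_inj c.1); rewrite // /incident ?eq_cl eqxx.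
have /fset0Pn[d] := T1 c cT not_last.
rewrite !inE /= => /andP[dT rn_cd]; apply: (Pstep c d) => //.
by apply: IHN => //; have := last_chord_max l_last dT; case/and3P: rn_cd; lia.
Qed.

(** With [d] the neighbor of lesser source, a path from [c] through [d'] to [l] stays to the right
    of [d.1] after [c] and ends beyond [d.2]. The nested and crossing cases need no separation: if
    [d'] ends after [d], cutting the path off yields a [T_3]. *)
Lemma right_neighbor_unique (l c d d' : chord) :
    top_cycle_free T -> one_terminal T -> last_chord T l ->
    c \in T -> d \in T -> d' \in T ->
    right_neighbor c d -> right_neighbor c d' ->
  d = d'.
Proof.
move=> T_tcf T1 l_last cT.
wlog lt_dd' : d d' / d.1 < d'.1.
  move=> wlog_lt dT d'T rn_d rn_d'; have [lt|gt|eq] := ltngtP d.1 d'.1.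
  - exact: wlog_lt.
  - by apply/esym/wlog_lt.
  - by apply: (@incident_inj d.1); rewrite // /incident ?eq eqxx.
move=> dT d'T rn_d rn_d'; exfalso.
(* Sinks grow along right neighbors, so the chord with the last source also has the last sink. *)
have sink_max (x : chord) : x \in T -> x.2 <= l.2.
  move: x; apply: (right_neighbor_ind T1 l_last) => // x y _ _ /and3P[]; lia.
have [lT _] := l_last.
have lt_l : d.2 < l.2.
  have ne : d.1 != l.1.
    by have := last_chord_max l_last d'T; lia.
  by have := endpoints_neq dT lT ne; have := sink_max d dT; lia.
have [k [e [e0 ek eT e_rn]]] : exists k e, [/\ e 0 = d', e k = l,
    forall i, i <= k -> e i \in T
    & forall i, i < k -> right_neighbor (e i) (e i.+1)].
  move: (d') d'T; apply: (right_neighbor_ind T1 l_last).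
    by exists 0, (fun=> l).
  move=> x y xT _ rn_xy [k [e [e0 ek eT e_rn]]].
  exists k.+1, (fun i => if i is j.+1 then e j else x).
  split=> // [[|i]|[|i]] // ik; [exact: eT | by rewrite e0 | exact: e_rn].
have e_source i : i <= k -> d.1 < (e i).1.
  elim: i => [|i IHi] ik; first by rewrite e0.
  by have := IHi (ltnW ik); have /and3P[] := e_rn i ik; lia.
apply: (@top_cycle_of_long_path k.+1
          (fun i => if i is j.+1 then e j else c) d) => //.
- by case=> // i; apply: eT.
- by case=> [|i] ik; [rewrite e0 | apply: e_rn].
- by case=> // i /andP[_ ik]; apply: e_source.
- by rewrite ek.
Qed.

(** * Terminal chords and cycles when right neighbors are unique *)

Lemma last_of_terminal (t : chord) :
    (forall x y : T, connect (intersection_graph T) x y) ->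
    (forall c, c \in T -> ~~ terminal T c -> #|` right_neighbors T c| = 1) ->
    t \in T -> terminal T t ->
  last_chord T t.
Proof.
move=> conn rn1 tT t_term; split=> // d dT.
have rn_mem (x y : T) : right_neighbor (val x) (val y) ->
    val y \in right_neighbors T (val x).
  by move=> rn_xy; rewrite !inE /= rn_xy (valP y).
pose rn : rel T := fun x y => right_neighbor (val x) (val y).
pose t' : T := [` tT].
have reach_closed : closed (intersection_graph T) [pred x : T | connect rn x t'].
  (* A crossing is a right-neighbor relation in one of the two directions, so one direction
     suffices. *)
  suff half (x y : T) : rn x y -> connect rn x t' = connect rn y t'.
    by move=> x y; rewrite !inE => /orP[/half | /half] ->.
  move=> rn_xy; apply/idP/idP; last exact: connect_trans (connect1 rn_xy).
  have x_nonterm : ~~ terminal T (val x).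
    by apply/fset0Pn; exists (val y); apply: rn_mem.
  (* The path from [x] to [t'] is nonempty, as only [t'] is terminal here, and by uniqueness its
     first step leads to [y]. *)
  case/connectP=> [[|z p]] /=.
    by move=> _ eq_t; rewrite -eq_t /= t_term in x_nonterm.
  case/andP=> rn_xz p_path t_last.
  have /eqP/cardfs1P[w Dw] := rn1 _ (valP x) x_nonterm.
  have := rn_mem _ _ rn_xy; have := rn_mem _ _ rn_xz.
  rewrite Dw !inE => /eqP zw /eqP yw.
  have -> : y = z by apply: val_inj; rewrite yw zw.
  by apply/connectP; exists p.
have := closed_connect reach_closed (conn [` dT] t').
rewrite !inE connect0 => /connectP[p]; rewrite -[d]/(val [` dT]) -[t]/(val t').
elim: p [` dT] => [|y p IHp] x /=; first by move=> _ <-.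
by case/andP=> /and3P[lt_xy _ _] /IHp le_yt /le_yt; apply/leq_trans/ltnW.
Qed.

Lemma no_ucycle (s : seq T) :
    (forall c d d' : chord, c \in T -> d \in T -> d' \in T ->
       right_neighbor c d -> right_neighbor c d' -> d = d') ->
    3 <= size s -> ~ ucycle (intersection_graph T) s.
Proof.
move=> rn_uniq s_ge3 s_cycle.
have [x0 x0s] : exists x0, x0 \in s.
  by case: s s_ge3 {s_cycle} => // x s; exists x; rewrite mem_head.
case: (arg_minnP (fun x : T => (val x).1) x0s) => x xs x_min.
have [i s' Ds] := rot_to xs.
have x_rn y :
    y \in s -> crosses (val x) (val y) -> right_neighbor (val x) (val y).
  move=> /x_min x_le /orP[// | /and3P[lt_yx _ _]].
  by rewrite leqNgt lt_yx in x_le.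
have s'_s y : y \in s' -> y \in s.
  by move=> ys'; rewrite -(mem_rot i) Ds inE ys' orbT.
have s'_size : 2 <= size s' by move: s_ge3; rewrite -(size_rot i) Ds.
move: s_cycle; rewrite -(rot_ucycle i) Ds => /andP[].
(* The successor [y] and predecessor [z] of [x] differ because the cycle has at least three chords;
   both are right neighbors of [x], whose source is least. *)
case: s' {Ds} s'_s s'_size => // y; elim/last_ind => // s' z _ s'_s _.
rewrite /= rcons_path last_rcons => /and3P[cr_xy _ cr_zx] /and3P[_ + _].
rewrite mem_rcons inE negb_or => /andP[/eqP ne_yz _]; case: ne_yz.
apply: val_inj; apply: (rn_uniq (val x)); rewrite ?(valP x) ?(valP y) ?(valP z) //.
  by apply: x_rn; rewrite ?s'_s ?mem_head.
apply: x_rn; first by rewrite s'_s // inE mem_rcons mem_head orbT.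
by rewrite /crosses orbC.
Qed.

End Diagram.

Theorem lemma8p4 (n : nat) (T : {fset nat * nat})
    (T_diagram : chord_diagram n T) (T_nonempty : T <> fset0)
    (T_tcf : top_cycle_free T) :
  one_terminal T <->
  is_tree (intersection_graph T) /\
  (forall c : nat * nat, c \in T -> ~~ terminal T c ->
     #|` right_neighbors T c| = 1).
Proof.
split=> [T1 | [[_ conn _] rn1] c cT not_last]; last first.
  by apply/negP => c_term; apply: not_last; apply: last_of_terminal.
have /fset0Pn[c0 c0T] : T != fset0 by apply/eqP.
have [l l_last] : exists l, last_chord T l.
  case: (@arg_maxnP T [` c0T] xpredT (fun c => (val c).1)) => // l _ l_max.
  by exists (val l); split=> [|d dT]; [apply: valP | apply: (l_max [` dT])].
have rn_uniq c d d' := @right_neighbor_unique n T T_diagram l c d d' T_tcf T1 l_last.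
split; last first.
  move=> c cT /fset0Pn[d]; rewrite !inE /= => /andP[dT rn_d].
  apply/eqP/cardfs1P; exists d; apply/fsetP => d'; rewrite !inE /=.
  apply/andP/eqP => [[d'T rn_d'] | -> //]; exact: (rn_uniq c).
split.
- by apply/card_gt0P; exists [` c0T].
- have graph_sym : symmetric (intersection_graph T).
    by move=> x y; rewrite /intersection_graph /crosses orbC.
  (* The induction runs over chords, while the graph has elements of the subtype as vertices;
     [val x = c] links the two. *)
  have to_last (c : chord) : c \in T -> forall x : T, val x = c ->
      connect (intersection_graph T) x [` l_last.1].
    move: c; apply: (right_neighbor_ind T_diagram T1 l_last).
      by move=> x xl; rewrite (_ : x = [` l_last.1]) ?connect0 //; apply: val_inj.
    move=> c d _ dT rn_cd IHd x xc.
    apply: connect_trans (IHd [` dT] _) => //; apply: connect1.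
    by rewrite /intersection_graph /crosses xc rn_cd.
  move=> x y; apply: connect_trans (to_last _ (valP x) _ _) _ => //.
  by rewrite (sym_connect_sym graph_sym) (to_last _ (valP y)).
- by move=> s; apply: no_ucycle.
Qed.
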